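(* Let $\mathcal{K}$ and $\mathcal{H}$ be Hilbert spaces. Assume that $R:\mathcal{K}\to\mathfrak{B}(\mathcal{H})$ is a positive function with parallelogram identity such that (i) $R(-\eta)=R(i\eta)=R(\eta)$ for every $\eta\in\mathcal{K}$; (ii) for any $\xi,\eta\in\mathcal{K}$ the map $\mathbb{R}\ni\alpha\mapsto R(\xi+\alpha\eta)\in\mathfrak{B}(\mathcal{H})$ is continuous at zero; (iii) for any $\varepsilon>0$ there are $n\in\mathbb{N}$, $\zeta_1,\ldots,\zeta_n\in\mathcal{K}$ and $\delta>0$ such that for any $m\in\mathbb{N}$, $\xi_1,\ldots,\xi_m,\eta_1,\ldots,\eta_m\in\mathcal{K}$ the condition $\left\Vert\sum_{i=1}^m\langle\xi_i,\zeta_j\rangle\eta_i\right\Vert<\delta$ for $j=1,\ldots,n$ implies $\left\Vert\sum_{i=1}^m\bigl(R(\eta_i+\xi_i)-R(\eta_i-\xi_i)\bigr)\right\Vert<\varepsilon$. Then there is a positive map $\phi:\mathfrak{B}(\mathcal{K})\to\mathfrak{B}(\mathcal{H})$ such that $\phi(\eta\eta^* )=R(\eta)$ for each $\eta\in\mathcal{K}$. Moreover, the map $\phi$ is uniquely determined, and it is continuous with respect to the strong topology in the domain and the uniform topology in the codomain.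
   Context: Hilbert spaces are complex and not necessarily finite dimensional. $\mathfrak{B}(\mathcal{H})$ denotes the $C^*$-algebra of bounded operators on $\mathcal{H}$; the uniform topology is the operator norm topology and the strong topology is the strong operator topology. Inner products are linear in the second variable, and $\eta\eta^*$ is the operator $\tau\mapsto\langle\eta,\tau\rangle\eta$. A function $R:\mathcal{K}\to\mathfrak{B}(\mathcal{H})$ fulfils the parallelogram identity if $R(\xi+\eta)+R(\xi-\eta)=2R(\xi)+2R(\eta)$ for all $\xi,\eta\in\mathcal{K}$; if additionally $R(\eta)\geq0$ for every $\eta\in\mathcal{K}$, $R$ is called a positive function with parallelogram identity. A positive map $\phi:\mathfrak{B}(\mathcal{K})\to\mathfrak{B}(\mathcal{H})$ is a linear map that sends positive operators to positive operators.
   Formalization: Uniqueness of φ is proved among positive maps with φ(ηη* )=R(η) that are strong-to-uniform continuous; among all positive maps it fails for infinite-dimensional K (R=0, H=ℂ: both 0 and a state vanishing on compact operators qualify). *)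

(* Defs.v *)
From HB Require Import structures.
From mathcomp Require Import all_boot all_order all_algebra complex.
From mathcomp Require Import boolp classical_sets functions reals topology.
From mathcomp Require Import normedtype.

Set Implicit Arguments.
Unset Strict Implicit.
Unset Printing Implicit Defensive.

Import Order.TTheory GRing.Theory Num.Theory.
Import numFieldNormedType.Exports.

Local Open Scope classical_set_scope.
Local Open Scope complex_scope.
Local Open Scope ring_scope.

HB.mixin Record CompleteNormedModule_isHilbert (R : realType) V
    & CompleteNormedModule R[i] V := {
  hilbert_dot : {dot V for @Num.conj R[i]};
  hilbert_dot_norm : forall x : V, hilbert_dot x x = `|x| ^+ 2
}.

#[short(type="hilbertType")]
HB.structure Definition Hilbert (R : realType) :=
  {V of CompleteNormedModule R[i] V & CompleteNormedModule_isHilbert R V}.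

(* [{dot _ for _}] is linear in its first argument; the inner product below is
   linear in the second one, hence the swap. *)
Definition inner (R : realType) (V : hilbertType R) (x y : V) : R[i] :=
  hilbert_dot y x.

Notation "''[' x , y ]" := (inner x y) : ring_scope.

Section InnerTheory.
Context (R : realType) (V : hilbertType R).
Implicit Types (a : R[i]) (x y z : V).

Lemma innerDr x y z : '[x, y + z] = '[x, y] + '[x, z].
Proof. exact: linearDl. Qed.

Lemma innerZr a x y : '[x, a *: y] = a * '[x, y].
Proof. exact: linearZl_LR. Qed.

Lemma innerC x y : '[x, y] = Num.conj '[y, x].
Proof. by rewrite /inner hermC expr0 mul1r. Qed.

Lemma innerDl x y z : '[x + y, z] = '[x, z] + '[y, z].
Proof. by rewrite innerC innerDr rmorphD [in RHS](innerC x) (innerC y). Qed.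

Lemma innerZl a x y : '[a *: x, y] = Num.conj a * '[x, y].
Proof. by rewrite innerC innerZr rmorphM [in RHS](innerC x). Qed.

Lemma inner_norm x : '[x, x] = `|x| ^+ 2.
Proof. exact: hilbert_dot_norm. Qed.

Lemma inner_CauchySchwarz x y : `|'[x, y]| <= `|x| * `|y|.
Proof.
have [->|x0] := eqVneq x 0.
  by rewrite -[0 : V](scale0r 0) innerZl conjC0 mul0r normr0 mulr_ge0.
pose a := '[x, y] / '[x, x]; pose z := y - a *: x.
have nx0 : '[x, x] != 0 by rewrite inner_norm expf_neq0 ?normr_eq0.
have zx : '[x, z] = 0.
  by rewrite /z -scaleNr innerDr innerZr mulNr divfK ?subrr.
have xz : '[z, x] = 0 by rewrite innerC zx conjC0.
have yE : y = a *: x + z by rewrite /z addrC subrK.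
have aE : '[x, y] = a * '[x, x] by rewrite divfK.
clearbody a z.
have : `|a| ^+ 2 * `|x| ^+ 2 <= `|y| ^+ 2.
  rewrite -[leRHS]inner_norm yE innerDl !innerDr !innerZl !innerZr zx xz.
  rewrite !mulr0 addr0 add0r !inner_norm.
  have -> b : Num.conj a * (a * b) = `|a| ^+ 2 * b.
    by rewrite normCK [a * Num.conj a]mulrC mulrA.
  by rewrite lerDl exprn_ge0.
move=> h; have xp : 0 < `|x| by rewrite normr_gt0.
rewrite -(@ler_pXn2r _ 2) ?nnegrE ?mulr_ge0 // exprMn aE inner_norm.
have -> : `|a * `|x| ^+ 2| ^+ 2 = `|x| ^+ 2 * (`|a| ^+ 2 * `|x| ^+ 2).
  by rewrite normrM normrX normr_id exprMn [RHS]mulrCA; congr (_ * _).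
by rewrite ler_wpM2l ?exprn_ge0.
Qed.

End InnerTheory.

Section BoundedOperators.
Context (R : realType) (H : hilbertType R).

Definition bounded_operator : {pred H -> H} :=
  mem [set f | linear f /\ exists M : R, forall x, `|f x| <= M%:C * `|x|].

Record bop := Bop { bop_fun :> H -> H; bopP : bop_fun \in bounded_operator }.
HB.instance Definition _ := [isSub for bop_fun].
HB.instance Definition _ := [Choice of bop by <:].

Lemma bounded_operator_submod : submod_closed bounded_operator.
Proof.
split.
  rewrite inE; split=> [a x y|]; first by rewrite /= scaler0 addr0.
  by exists 0 => x; rewrite normr0 mul0r.
move=> a f g; rewrite !inE => -[fl [M fM]] [gl [N gN]].
split=> [b x y|].
  change (a *: f (b *: x + y) + g (b *: x + y) =
    b *: (a *: f x + g x) + (a *: f y + g y)).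
  by rewrite fl gl !scalerDr !scalerA [a * b]mulrC addrACA.
pose A : R := complex.Re `|a|; exists (A * M + N) => x.
change (`|a *: f x + g x| <= (A * M + N)%:C * `|x|).
rewrite (le_trans (ler_normD _ _))// rmorphD rmorphM/= RRe_real ?normr_real//.
by rewrite normrZ mulrDl lerD// -mulrA ler_wpM2l.
Qed.
HB.instance Definition _ :=
  GRing.isSubmodClosed.Build _ _ bounded_operator bounded_operator_submod.
HB.instance Definition _ := [SubChoice_isSubLmodule of bop by <:].

Lemma bop_linear (T : bop) : linear T.
Proof. by have := bopP T; rewrite inE => -[]. Qed.
HB.instance Definition _ (T : bop) :=
  GRing.isLinear.Build R[i] H H *:%R T (bop_linear T).

Lemma bop_bounded (T : bop) : exists M : R, forall x, `|T x| <= M%:C * `|x|.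
Proof. by have := bopP T; rewrite inE => -[]. Qed.

Lemma bopD (S T : bop) x : (S + T) x = S x + T x. Proof. by []. Qed.
Lemma bopZ a (T : bop) x : (a *: T) x = a *: T x. Proof. by []. Qed.
Lemma bop_eq (S T : bop) : S =1 T -> S = T.
Proof. by move=> ST; apply/val_inj/funext. Qed.

(* Norms of [R[i]]-modules take their values in [R[i]]. *)
Definition opnorm (T : bop) : R[i] :=
  (sup [set complex.Re `|T x| | x in [set x : H | `|x| <= 1]])%:C.

Let unit_image (T : bop) := [set complex.Re `|T x| | x in [set x : H | `|x| <= 1]].

Let ReK (x : H) : (complex.Re `|x|)%:C = `|x|.
Proof. by rewrite RRe_real ?normr_real. Qed.

Let unit_image_has_sup T : has_sup (unit_image T).
Proof.
split; first by exists (complex.Re `|T 0|), 0; rewrite //= normr0 ler01.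
have [M TM] := bop_bounded T; exists `|M| => _ [x /= x1 <-].
rewrite -lecR ReK (le_trans (TM x))//.
rewrite (@le_trans _ _ (`|M|%:C * `|x|))//.
  by rewrite ler_wpM2r// lecR ler_norm.
by rewrite -[leRHS]mulr1 ler_wpM2l// ler0c.
Qed.

Lemma opnorm_ge0 T : 0 <= opnorm T.
Proof.
rewrite ler0c; apply: (sup_upper_bound (unit_image_has_sup T)).
by exists 0; rewrite /= ?linear0 normr0 ?ler01.
Qed.

Lemma ler_opnorm (T : bop) (x : H) : `|T x| <= opnorm T * `|x|.
Proof.
have [->|x0] := eqVneq x 0; first by rewrite linear0 !normr0 mulr0.
have xp : 0 < `|x| by rewrite normr_gt0.
rewrite -ler_pdivrMr//.
have -> : `|T x| / `|x| = `|T (`|x|^-1 *: x)|.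
  by rewrite linearZ/= normrZ normrV ?unitfE ?normr_eq0// normr_id mulrC.
rewrite -ReK lecR; apply: (sup_upper_bound (unit_image_has_sup T)).
exists (`|x|^-1 *: x) => //=.
by rewrite normrZ normrV ?unitfE ?normr_eq0// normr_id mulVf// normr_eq0.
Qed.

Lemma opnorm_le (T : bop) (c : R[i]) :
  0 <= c -> (forall x, `|T x| <= c * `|x|) -> opnorm T <= c.
Proof.
move=> c0 Tc; rewrite -[c]RRe_real ?ger0_real// lecR.
apply: ge_sup; first by case: (unit_image_has_sup T).
move=> _ [x /= x1 <-]; rewrite -lecR ReK RRe_real ?ger0_real//.
by rewrite (le_trans (Tc x))// -[leRHS]mulr1 ler_wpM2l.
Qed.

Let opnormD (S T : bop) : opnorm (S + T) <= opnorm S + opnorm T.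
Proof.
apply: opnorm_le => [|x]; first by rewrite addr_ge0 ?opnorm_ge0.
by rewrite bopD (le_trans (ler_normD _ _))// mulrDl lerD ?ler_opnorm.
Qed.

Let opnormZ (a : R[i]) (T : bop) : opnorm (a *: T) = `|a| * opnorm T.
Proof.
have le b S : opnorm (b *: S) <= `|b| * opnorm S.
  apply: opnorm_le => [|x]; first by rewrite mulr_ge0 ?opnorm_ge0.
  by rewrite bopZ normrZ -mulrA ler_wpM2l ?ler_opnorm.
apply/le_anti; rewrite le/=; have [->|a0] := eqVneq a 0.
  by rewrite normr0 mul0r opnorm_ge0.
rewrite -ler_pdivlMl ?normr_gt0//.
by rewrite -{1}[T](scalerK a0) (le_trans (le _ _))// normfV.
Qed.

Let opnorm_eq0 (T : bop) : opnorm T = 0 -> T = 0.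
Proof.
move=> T0; apply: bop_eq => x; apply/eqP; rewrite -normr_le0.
by rewrite (le_trans (ler_opnorm _ _))// T0 mul0r.
Qed.

HB.instance Definition _ :=
  Lmodule_isNormed.Build R[i] bop opnormD opnormZ opnorm_eq0.

Lemma bop_normE (T : bop) : `|T| = opnorm T. Proof. by []. Qed.

Definition positive_op (T : bop) := forall x : H, 0 <= '[x, T x].

Definition ketbra_fun (y z x : H) : H := '[z, x] *: y.

Lemma ketbra_bounded y z : ketbra_fun y z \in bounded_operator.
Proof.
rewrite inE; split=> [a u v|].
  by rewrite /ketbra_fun innerDr innerZr scalerDl scalerA.
exists (complex.Re `|z| * complex.Re `|y|) => x.
rewrite rmorphM/= !ReK normrZ mulrAC.
by rewrite ler_wpM2r// inner_CauchySchwarz.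
Qed.

(* The operator usually written [y z^*]. *)
Definition ketbra (y z : H) : bop := Bop (ketbra_bounded y z).

(* The same carrier with the strong operator topology, i.e., the one induced by
   pointwise convergence; [bop] itself carries the operator-norm topology. *)
Definition strong_bop : Type :=
  @initial_topology bop {ptws H -> H} bop_fun.
HB.instance Definition _ := Topological.copy strong_bop
  (@initial_topology bop {ptws H -> H} bop_fun).

End BoundedOperators.

Notation "''B(' H )" := (bop H) (at level 0, format "''B(' H )") : type_scope.

Section MapsBetweenOperators.
Context (R : realType) (K H : hilbertType R).

Definition parallelogram_identity (Q : K -> 'B(H)) :=
  forall x y, Q (x + y) + Q (x - y) = 2 *: Q x + 2 *: Q y.

Definition positive_parallelogram (Q : K -> 'B(H)) :=
  parallelogram_identity Q /\ forall x, positive_op (Q x).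

Definition positive_map (phi : {linear 'B(K) -> 'B(H)}) :=
  forall T, positive_op T -> positive_op (phi T).

Definition strong_uniform_continuous (phi : 'B(K) -> 'B(H)) :=
  continuous (phi : strong_bop K -> 'B(H)).

End MapsBetweenOperators.

(* Main.v *)
From HB Require Import structures.
Require Import Defs.
From mathcomp Require Import all_boot all_order all_algebra complex.
From mathcomp Require Import boolp classical_sets functions reals topology.
From mathcomp Require Import normedtype ring.

(** The map is determined on rank-one operators by polarization: writing
    S(x, y) = Q (x + y) - Q (x - y), it must send the rank-one operator of the
    pair (x, y) to L(x, y) = (S(x, y) + i S(x, i y)) / 4.  The parallelogram
    identity makes S additive in each variable (the Jordan-von Neumann
    argument), continuity makes it homogeneous over the reals, and invariance
    of Q under i makes L linear in x, with L(x, x) = Q x.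

    Let z_1, ..., z_n be the vectors that the strong continuity hypothesis
    provides for epsilon = 1.  Since L is homogeneous, scaling
    shows that if the finite-rank operator F, the sum of the rank-one
    operators of pairs (x_k, y_k), kills every z_j, then the sum of the
    L(x_k, y_k) vanishes ([complex_polar_sum_eq0]).  Hence that sum depends
    only on the values F z_j, and it makes sense to define phi T as its value
    at any finite-rank F that agrees with T on the z_j: no limit is taken.

    Such an F is found by repeated Schur complements.  If T is positive and a
    is a vector, then T minus the rank-one positive operator
    (T a)(T a)^* / <a, T a> is positive and kills a.  Iterating, a positive
    T agrees on any finite list of vectors with a finite sum of operators
    e e^* ([positive_op_interpolation]).
    - For the identity this gives vectors e_k such that the sum of
      <e_k, z_j> e_k is z_j, so an arbitrary T agrees on the z_j with the
      finite-rank operator of the pairs (T e_k, e_k), and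
      phi T is the sum of the L(T e_k, e_k).  This formula is linear in T, and
      it is strongly continuous since each L(., e_k) is bounded.
    - For a positive T it shows that phi T is a finite sum of values of Q,
      hence positive.
    The identity case also shows that finite-rank operators are strongly
    dense, so a strongly continuous linear map is determined by its values on
    rank-one operators ([strong_continuous_ketbra_eq]); this gives
    uniqueness. *)

Import numFieldNormedType.Exports.
Import Order.TTheory GRing.Theory Num.Theory.

Local Open Scope classical_set_scope.
Local Open Scope complex_scope.
Local Open Scope ring_scope.

Set Implicit Arguments.
Unset Strict Implicit.
Unset Printing Implicit Defensive.

(** * Polarization of a quadratic function *)

Definition polar (U V : zmodType) (Q : U -> V) (x y : U) : V :=
  Q (x + y) - Q (x - y).

Section Polar.
Context (F : numFieldType) (U : zmodType) (V : lmodType F) (Q : U -> V).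
Context (Qpar : forall x y, Q (x + y) + Q (x - y) = 2 *: Q x + 2 *: Q y).
Context (Qeven : forall x, Q (- x) = Q x).

Lemma polarDB x z y :
  polar Q (x + z) y + polar Q (x - z) y = 2 *: polar Q x y.
Proof.
rewrite /polar addrACA -opprD [x + z + y]addrAC [x - z + y]addrAC.
rewrite [x + z - y]addrAC [x - z - y]addrAC !Qpar opprD addrACA subrr addr0.
by rewrite scalerBr.
Qed.

Lemma polar0l y : polar Q 0 y = 0.
Proof. by rewrite /polar add0r sub0r Qeven subrr. Qed.

(** The identity [polarDB] at x = z doubles the first argument; at x + z and
    x - z it then gives twice the desired equation. *)
Lemma polarDl x z y : polar Q (x + z) y = polar Q x y + polar Q z y.
Proof.
have dbl u : polar Q (u + u) y = 2 *: polar Q u y.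
  by rewrite -(polarDB u u) subrr polar0l addr0.
have := polarDB (x + z) (x - z) y.
have -> : x + z + (x - z) = x + x by rewrite addrACA subrr addr0.
have -> : x + z - (x - z) = z + z.
  by rewrite opprB [x + z]addrC addrACA subrr addr0.
rewrite !dbl -scalerDr.
by move/(scalerI (_ : 2 != 0 :> F)) => ->//; rewrite pnatr_eq0.
Qed.

Lemma diag_polar x : polar Q x x = 4 *: Q x.
Proof.
have Q0 : Q 0 = 0.
  have /eqP := Qpar 0 0; rewrite subr0 addr0 -scalerDr scaler_nat mulr2n.
  rewrite eq_sym -subr_eq0 addrK -mulr2n -scaler_nat scaler_eq0 pnatr_eq0.
  by move/eqP.
have := Qpar x x.
rewrite /polar subrr Q0 subr0 addr0 -scalerDl => ->.
by rewrite -natrD.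
Qed.

End Polar.

Lemma real_complex_continuous (R : realType) :
  continuous (fun x : R => x%:C : (R[i] : numFieldType)).
Proof.
move=> x; apply/cvgrPdist_lt => e e0.
have eR : (complex.Re e)%:C = e by rewrite RRe_real// gtr0_real.
have : \forall y \near x, `|x - y| < complex.Re e.
  apply: (@cvgr_dist_lt _ _ _ (nbhs x) _ id x); first exact: cvg_id.
  by rewrite -ltcR eR.
apply: filterS => y.
by rewrite -rmorphB/= normc_def/= expr0n/= addr0 sqrtr_sqr -eR ltcR.
Qed.

(** The defect g of homogeneity is additive, continuous at 0 and zero at every
    rational, so its value at a is its value at arbitrarily small a - q. *)
Lemma additive_continuous_homogeneous (R : realType) (V : normedModType R[i])
    (f : R -> V) :
  (forall a b, f (a + b) = f a + f b) -> {for 0, continuous f} ->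
  forall a, f a = a%:C *: f 1.
Proof.
move=> fD fc a.
pose g := fun x => f x - x%:C *: f 1.
have gD x y : g (x + y) = g x + g y.
  by rewrite /g fD rmorphD/= scalerDl opprD addrACA.
have g0 : g 0 = 0 by apply: (addIr (g 0)); rewrite -gD !add0r.
have gN x : g (- x) = - g x by apply/eqP; rewrite -addr_eq0 -gD addNr g0.
have gMn x n : g (x *+ n) = g x *+ n.
  by elim: n => [|n IH]; rewrite ?mulr0n// !mulrS gD IH.
have g1 : g 1 = 0 by rewrite /g scale1r subrr.
have gint (z : int) : g z%:~R = 0.
  by case: z => n; rewrite ?NegzE ?mulrNz ?gN -pmulrn gMn g1 mul0rn ?oppr0.
have grat (q : rat) : g (ratr q) = 0.
  have dq : (0 < `|denq q|)%N by rewrite absz_gt0 denq_neq0.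
  have : g (ratr q) *+ `|denq q|%N = 0.
    rewrite -gMn -mulr_natr pmulrn absz_denq.
    have -> : ratr q * (denq q)%:~R = (numq q)%:~R :> R.
      by rewrite /ratr divfK// intr_eq0 denq_neq0.
    exact: gint.
  move/eqP; rewrite -scaler_nat scaler_eq0 pnatr_eq0.
  by rewrite -[_ == 0%N]leqn0 leqNgt dq/= => /eqP.
suff : g a = 0 by move/eqP; rewrite subr_eq0 => /eqP.
apply/eqP; rewrite -normr_le0; apply/ler_addgt0Pl => e e0; rewrite addr0.
have gc : g x @[x --> 0] --> g 0.
  apply: cvgB => //; apply: cvgZr_tmp; exact: real_complex_continuous.
have /cvgrPdist_lt/(_ _ e0)/nbhs_ballP[d /= d0 gd] := gc.
have /rat_in_itvoo[q] : a - d < a by rewrite ltrBlDr ltrDl.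
rewrite in_itv/= => /andP[q1 q2].
have := gd (a - ratr q); rewrite /ball/= g0 !sub0r !normrN.
rewrite gtr0_norm ?subr_gt0// gD gN grat subr0 => /(_ _)/ltW; apply.
by rewrite ltrBlDr -ltrBlDl.
Qed.

(** For a quadratic form Q invariant under i, this is the sesquilinear form,
    linear in its first argument, whose diagonal is Q.  It is the polarization
    sum over the fourth roots of unity, grouped by pairs of opposite roots. *)
Definition complex_polar (R : realType) (K V : lmodType R[i]) (Q : K -> V)
    (x y : K) : V :=
  4^-1 *: (polar Q x y + 'i *: polar Q x ('i *: y)).

Section ComplexPolar.
Context (R : realType) (K : lmodType R[i]) (V : normedModType R[i]).
Context (Q : K -> V).
Context (Qpar : forall x y, Q (x + y) + Q (x - y) = 2 *: Q x + 2 *: Q y).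
Context (Qeven : forall x, Q (- x) = Q x) (Qi : forall x, Q ('i *: x) = Q x).
Context (Qcont : forall x y : K,
  {for (0 : R), continuous (fun a : R => Q (x + a%:C *: y))}).

Let mulii (W : lmodType R[i]) (x : W) : 'i *: ('i *: x) = - x.
Proof. by rewrite scalerA -expr2 sqrCi scaleN1r. Qed.

Let scaleC (W : lmodType R[i]) (a b : R[i]) (x : W) :
  a *: (b *: x) = b *: (a *: x).
Proof. by rewrite !scalerA mulrC. Qed.

Lemma polar_real_scalel (a : R) x y :
  polar Q (a%:C *: x) y = a%:C *: polar Q x y.
Proof.
have := @additive_continuous_homogeneous R V (fun b => polar Q (b%:C *: x) y).
move=> /(_ _ _ a)/=; rewrite scale1r; apply.
  by move=> b c; rewrite rmorphD scalerDl polarDl.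
rewrite /polar; apply: cvgB.
  by under eq_fun do rewrite addrC; rewrite addrC; exact: Qcont.
by under eq_fun do rewrite addrC; rewrite addrC; exact: Qcont.
Qed.

Lemma polar_il x y : polar Q ('i *: x) y = - polar Q x ('i *: y).
Proof.
have e z : Q ('i *: x + z) = Q (x - 'i *: z).
  by rewrite -[RHS]Qi scalerBr mulii opprK.
by rewrite /polar !e scalerN opprK opprB.
Qed.

Lemma complex_polar_linear y : linear (complex_polar Q ^~ y).
Proof.
have rl (a : R) x : complex_polar Q (a%:C *: x) y = a%:C *: complex_polar Q x y.
  rewrite /complex_polar !polar_real_scalel ['i *: _]scaleC -scalerDr.
  exact: scaleC.
have il x : complex_polar Q ('i *: x) y = 'i *: complex_polar Q x y.
  rewrite /complex_polar !polar_il mulii [RHS]scaleC.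
  rewrite [in RHS]scalerDr mulii addrC scalerN; congr (_ *: (_ + _)).
  by rewrite /polar opprK -scalerN opprB.
have dl x z :
    complex_polar Q (x + z) y = complex_polar Q x y + complex_polar Q z y.
  rewrite /complex_polar !polarDl// -[RHS]scalerDr [in RHS]addrACA.
  by rewrite -[in RHS]scalerDr.
move=> a x z; rewrite dl; congr (_ + _).
rewrite [a in LHS]complexE complexiE scalerDl dl -scalerA rl il rl.
by rewrite ['i *: _]scalerA -scalerDl -complexiE -complexE.
Qed.

Lemma diag_complex_polar x : complex_polar Q x x = Q x.
Proof.
rewrite /complex_polar.
have -> : polar Q x x = 4 *: Q x by exact: diag_polar.
(* i (x - i x) = x + i x, so Q takes the same value at x + i x and x - i x *)
have -> : polar Q x ('i *: x) = 0.
  rewrite /polar -[Q (x - _)]Qi scalerBr mulii opprK ['i *: x + x]addrC.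
  by rewrite subrr.
by rewrite scaler0 addr0 scalerA mulVf ?scale1r ?pnatr_eq0.
Qed.

End ComplexPolar.

(** * Positive operators and finite-rank interpolation *)

Section Inner.
Context (R : realType) (V : hilbertType R).
Implicit Types (x y z : V).

Lemma innerNr x y : '[x, - y] = - '[x, y].
Proof. by rewrite -scaleN1r innerZr mulN1r. Qed.

Lemma innerBr x y z : '[x, y - z] = '[x, y] - '[x, z].
Proof. by rewrite innerDr innerNr. Qed.

Lemma innerBl x y z : '[x - y, z] = '[x, z] - '[y, z].
Proof. by rewrite innerC innerBr rmorphB/= -!innerC. Qed.

Lemma inner0l x : '[0, x] = 0.
Proof. by rewrite -(subrr (0 : V)) innerBl subrr. Qed.

Lemma inner_eq0 x : ('[x, x] == 0) = (x == 0).
Proof. by rewrite inner_norm sqrf_eq0 normr_eq0. Qed.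

Lemma bopB (S T : 'B(V)) x : (S - T) x = S x - T x.
Proof. by []. Qed.

Lemma bop_sum (I : Type) (r : seq I) (F : I -> 'B(V)) x :
  (\sum_(i <- r) F i) x = \sum_(i <- r) F i x.
Proof. exact: (big_morph (fun S : 'B(V) => S x)). Qed.

End Inner.

Section PositiveOperators.
Context (R : realType) (H : hilbertType R).
Implicit Types (T : 'B(H)) (x z : H).

(** Over the complex numbers, positivity forces symmetry: the quadratic form
    is real at x + z and at x + i z. *)
Lemma positive_op_herm T x z : positive_op T -> '[x, T z] = ('[z, T x])^*%R.
Proof.
move=> T0.
have real u : ('[u, T u])^*%R = '[u, T u].
  by apply: conj_Creal; exact: ger0_real.
have := real (x + z); have := real (x + 'i *: z).
rewrite !linearD !linearZ/= !innerDl !innerDr !innerZl !innerZr.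
rewrite !rmorphD !rmorphM/= !conjCK conjCi (real x) (real z).
set p := '[x, T z]; set q := '[z, T x]; set b := '[z, T z]; set a := '[x, T x].
move=> h1 h2.
have e1 : q^*%R - p^*%R = p - q.
  apply: (mulfI (neq0Ci R[i])); apply: (addrI (a + 'i * (- 'i * b))).
  by transitivity (a + 'i * p + (- 'i * q + - 'i * ('i * b)));
    [rewrite -h1|]; ring.
have e2 : p^*%R + q^*%R = p + q.
  apply: (addrI (a + b)).
  by transitivity (a + p + (q + b)); [rewrite -h2|]; ring.
apply: (mulfI (_ : 2 != 0 :> R[i])); first by rewrite pnatr_eq0.
transitivity ((p + q) + (p - q)); first by ring.
by rewrite -e1 -e2; ring.
Qed.

(** The right-hand side is the quadratic form of T at x - s <z, T x> z.
    Keeping the parameter s free covers both proofs of the Cauchy-Schwarz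
    inequality for the form of T: s = 1 / <z, T z> when this is nonzero, and
    s large otherwise. *)
Lemma positive_op_quad T x z s : positive_op T -> 0 <= s ->
  0 <= '[x, T x] - s *+ 2 * `|'[z, T x]| ^+ 2
       + s ^+ 2 * `|'[z, T x]| ^+ 2 * '[z, T z].
Proof.
move=> T0 s0; have := T0 (x - (s * '[z, T x]) *: z).
rewrite [T (_ - _)]linearB/= [T (_ *: _)]linearZ/= innerBl !innerBr.
rewrite !innerZl !innerZr.
rewrite (positive_op_herm x z)// rmorphM/= (conj_Creal (ger0_real s0)) normCK.
by congr (0 <= _); ring.
Qed.

Lemma positive_op_ker T z : positive_op T -> '[z, T z] <= 0 -> T z = 0.
Proof.
move=> T0 z0; have c0 : '[z, T z] = 0 by apply/le_anti; rewrite z0 T0.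
suff w0 x : '[z, T x] = 0.
  by apply/eqP; rewrite -inner_eq0 (positive_op_herm _ _ T0) w0 conjC0.
apply/eqP; apply/negPn/negP => w0.
have p0 : 0 < `|'[z, T x]| ^+ 2 by rewrite exprn_gt0 ?normr_gt0.
have := fun s => @positive_op_quad T x z s T0; rewrite c0.
move: '[x, T x] (`|_| ^+ 2) (T0 x) p0 => A p A0 p0.
(* at this s the quadratic expression, affine since <z, T z> = 0, equals -1 *)
have s0 : 0 <= (A + 1) / (2 * p).
  by rewrite divr_ge0 ?addr_ge0 ?mulr_ge0 ?(ltW p0).
move=> /(_ _ s0); rewrite mulr0 addr0.
have -> : A - (A + 1) / (2 * p) *+ 2 * p = -1 by field; rewrite gt_eqF.
by rewrite oppr_ge0 ler10.
Qed.

(** Take e = T a / sqrt <a, T a>, or e = 0 if <a, T a> = 0, since then T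
    already kills a. *)
Lemma schur_complement T a : positive_op T ->
  exists e : H, positive_op (T - ketbra e e) /\ (T - ketbra e e) a = 0.
Proof.
move=> T0; have [c0|c0] := eqVneq '[a, T a] 0.
  exists 0; have -> : T - ketbra 0 0 = T.
    by apply: bop_eq => x; rewrite bopB /= /ketbra_fun scaler0 subr0.
  by split=> //; apply: positive_op_ker; rewrite ?c0.
set c := '[a, T a] in c0 *.
have cp : 0 < c by rewrite lt_neqAle eq_sym c0 T0.
pose k := (sqrtC c)^-1.
have kk : k * k = c^-1 by rewrite -invfM -expr2 sqrtCK.
have kR : k^*%R = k.
  by apply: conj_Creal; rewrite ger0_real// invr_ge0 sqrtC_ge0 ltW.
exists (k *: T a); split=> [x|]; rewrite bopB /= /ketbra_fun innerZl kR.
  rewrite innerBr innerZr innerZr (positive_op_herm x a T0).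
  have -> : '[T a, x] = '[a, T x].
    by rewrite innerC (positive_op_herm x a T0) conjCK.
  have := @positive_op_quad T x a c^-1 T0.
  rewrite invr_ge0 (ltW cp) => /(_ isT).
  rewrite -/c normCK -kk; congr (0 <= _).
  set A := '[x, _]; set w := '[a, _].
  have kc : k * k * c = 1 by rewrite kk mulVf.
  transitivity
    (A - 2 * (k * k) * (w * w^*%R) + k * k * (k * k * c) * (w * w^*%R)).
    by ring.
  by rewrite kc; ring.
have -> : '[T a, a] = c by rewrite innerC conj_Creal// ger0_real// T0.
by rewrite scalerA mulrAC kk mulVf// scale1r subrr.
Qed.

(** Successive Schur complements.  Once a complement kills a vector z, all the
    later ones do: subtracting e e^* can only decrease the form at z, which is
    already 0, and the form stays nonnegative, so [positive_op_ker] applies. *)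
Lemma positive_op_interpolation T (s : seq H) : positive_op T ->
  exists es : seq H, positive_op (T - \sum_(e <- es) ketbra e e) /\
    forall z, z \in s -> T z = \sum_(e <- es) ketbra e e z.
Proof.
move=> T0; elim: s => [|a s [es [S0 Ss]]].
  by exists [::]; rewrite big_nil subr0.
set S := T - _ in S0; have [e [P0 Pa]] := schur_complement a S0.
exists (e :: es); rewrite big_cons.
have PE : T - (ketbra e e + \sum_(e <- es) ketbra e e) = S - ketbra e e.
  by rewrite opprD addrCA addrC.
split; first by rewrite PE.
move=> z; rewrite big_cons inE => /predU1P[->|zs]; apply/eqP.
  by rewrite -subr_eq0 -bop_sum -bopD -bopB PE Pa.
have Sz : S z = 0 by rewrite bopB Ss// bop_sum subrr.
rewrite -subr_eq0 -bop_sum -bopD -bopB PE; apply/eqP/positive_op_ker => //.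
rewrite bopB Sz sub0r innerNr oppr_le0 /= /ketbra_fun innerZr [_ * _]mulrC.
by rewrite [X in _ * X]innerC -normCK exprn_ge0.
Qed.

Lemma idop_bounded : (id : H -> H) \in @bounded_operator R H.
Proof. by rewrite inE; split=> //; exists 1 => x; rewrite mul1r. Qed.

Definition idop : 'B(H) := Bop idop_bounded.

(** For the identity operator, taking successive Schur complements amounts to
    Gram-Schmidt orthogonalization. *)
Lemma local_unit (s : seq H) : exists es : seq H,
  forall z, z \in s -> \sum_(e <- es) '[e, z] *: e = z.
Proof.
have [x|es [_ esP]] := @positive_op_interpolation idop s.
  by rewrite inner_norm exprn_ge0.
by exists es => z /esP.
Qed.

End PositiveOperators.

(** * The strong operator topology *)

Section StrongTopology.
Context (R : realType) (K : hilbertType R).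

Lemma strong_eval_continuous (x : K) :
  continuous (fun T : strong_bop K => (T : 'B(K)) x).
Proof.
move=> T.
have h : {ptws, (@bop_fun R K) @ nbhs T --> (T : 'B(K))}.
  exact: (@initial_continuous 'B(K) {ptws K -> K} (@bop_fun R K)).
exact: (iffLR (@pointwise_cvgP K K _ (T : 'B(K)) _) h).
Qed.

Lemma strong_cvg (F : set_system 'B(K)) (T : 'B(K)) : Filter F ->
  (forall x, S x @[S --> F] --> T x) -> F --> (T : strong_bop K).
Proof.
move=> FF cvF A [_ [[B Bop <-] BT BA]].
have : {ptws, ((@bop_fun R K) @ F) --> (T : K -> K)} by apply/pointwise_cvgP.
move/(_ B); rewrite nbhs_filterE => h.
have FB : F ((@bop_fun R K) @^-1` B) by apply: h; rewrite nbhsE; exists B.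
exact: filterS BA FB.
Qed.

(** T is the strong limit of the finite-rank operators that agree with it on
    larger and larger finite lists of vectors.  They are organized into a
    filter indexed by those lists, along which f and g coincide. *)
Lemma strong_continuous_ketbra_eq (V : normedModType R[i])
    (f g : {linear 'B(K) -> V}) :
  continuous (f : strong_bop K -> V) -> continuous (g : strong_bop K -> V) ->
  (forall x y, f (ketbra x y) = g (ketbra x y)) -> f =1 g.
Proof.
move=> fc gc fg T.
pose B (s : seq K) := [set S : 'B(K) | {in s, S =1 T} /\ f S = g S].
pose F := filter_from [set: seq K] B.
have FF : ProperFilter F.
  apply: filter_from_proper.
    apply: filter_fromT_filter; first by exists [::].
    move=> s t; exists (s ++ t) => S [ST fgS].
    by split; split => // x xs; apply: ST; rewrite mem_cat xs ?orbT.
  move=> s _; have [es esP] := local_unit s.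
  exists (\sum_(e <- es) ketbra (T e) e); split.
    move=> x /esP xE; rewrite bop_sum -[in RHS]xE linear_sum.
    by apply: eq_bigr => e _; rewrite linearZ.
  by rewrite !linear_sum; apply: eq_bigr => e _; exact: fg.
have FT : F --> (T : strong_bop K).
  apply: strong_cvg => x A /nbhs_singleton Ax; exists [:: x] => // S [ST _].
  by rewrite /= ST ?inE.
have cf : f S @[S --> F] --> f T by apply: cvg_comp FT _; exact: fc.
have cg : g S @[S --> F] --> g T by apply: cvg_comp FT _; exact: gc.
have cgf : f S @[S --> F] --> g T.
  apply: cvg_trans cg; apply: near_eq_cvg.
  by exists [::] => // S [].
exact: (@cvg_unique V (@norm_hausdorff _ V) (f @ F) _ _ _ cf cgf).
Qed.

End StrongTopology.

(** * Polarization of rank-one operators *)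

Section Ketbra.
Context (R : realType) (K : hilbertType R).
Implicit Types (x y u : K).

Lemma ketbraDl x y u : ketbra (x + y) u = ketbra x u + ketbra y u.
Proof. by apply: bop_eq => v; rewrite bopD /= /ketbra_fun scalerDr. Qed.

Lemma ketbraDr x y u : ketbra u (x + y) = ketbra u x + ketbra u y.
Proof.
by apply: bop_eq => v; rewrite bopD /= /ketbra_fun innerDl scalerDl.
Qed.

Lemma ketbraZl a x y : ketbra (a *: x) y = a *: ketbra x y.
Proof.
by apply: bop_eq => v; rewrite bopZ /= /ketbra_fun !scalerA mulrC.
Qed.

Lemma ketbraZr a x y : ketbra x (a *: y) = a^*%R *: ketbra x y.
Proof. by apply: bop_eq => v; rewrite bopZ /= /ketbra_fun innerZl scalerA. Qed.

Lemma ketbra_polar x y :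
  polar (fun u => ketbra u u) x y = 2 *: (ketbra x y + ketbra y x).
Proof.
rewrite /polar -[- y]scaleN1r !(ketbraDl, ketbraDr, ketbraZl, ketbraZr).
rewrite rmorphN1 !scaleN1r opprK !opprD !opprK addrACA.
rewrite [_ + (- _ + _)]addrACA subrr add0r [X in _ + X]addrACA subrr addr0.
by rewrite -!mulr2n -mulrnDl -scaler_nat.
Qed.

Lemma ketbra_complex_polar x y :
  complex_polar (fun u => ketbra u u) x y = ketbra x y.
Proof.
rewrite /complex_polar !ketbra_polar ketbraZl ketbraZr conjCi.
rewrite ['i *: (2 *: _)]scalerA mulrC -scalerA -scalerDr.
rewrite ['i *: _]scalerDr ['i *: (- _ *: _)]scalerA ['i *: ('i *: _)]scalerA.
rewrite mulrN -expr2 sqrCi opprK scale1r scaleN1r addrACA subrr addr0.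
rewrite -mulr2n -[ketbra x y *+ 2]scaler_nat !scalerA -mulrA -natrM mulVf.
  by rewrite scale1r.
by rewrite pnatr_eq0.
Qed.

Lemma ketbra_polarization (V : lmodType R[i]) (f : {linear 'B(K) -> V})
    (Q : K -> V) x y :
  (forall u, f (ketbra u u) = Q u) -> f (ketbra x y) = complex_polar Q x y.
Proof.
move=> fQ; rewrite -ketbra_complex_polar /complex_polar /polar.
have fB u v : f (ketbra u u - ketbra v v) = Q u - Q v by rewrite linearB/= !fQ.
by rewrite linearZ linearD linearZ/= !fB.
Qed.

End Ketbra.

(** * Extension to all bounded operators *)

Lemma linear_ext (R : pzRingType) (U V : lmodType R) (f g : {linear U -> V}) :
  f =1 g -> f = g.
Proof.
case: f g => [f [[fa] [fz]]] [g [[ga] [gz]]] /= /funext fg.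
by subst g; congr (GRing.Linear.Pack (GRing.Linear.Class _ _)); congr (_ _);
  exact: Prop_irrelevance.
Qed.

Section Extension.
Context (R : realType) (K H : hilbertType R) (Q : K -> 'B(H)).
Context (Qpar : parallelogram_identity Q) (Qpos : forall x, positive_op (Q x)).
Context (Qeven : forall x, Q (- x) = Q x) (Qi : forall x, Q ('i *: x) = Q x).
Context (Qcont : forall x y : K,
  {for (0 : R), continuous (fun a : R => Q (x + a%:C *: y))}).
Context (n : nat) (z : 'I_n -> K) (d : R) (d0 : 0 < d).
Context (Qbound : forall (m : nat) (x y : 'I_m -> K),
  (forall j : 'I_n, `|\sum_(i < m) '[x i, z j] *: y i| < d%:C) ->
  `|\sum_(i < m) polar Q (y i) (x i)| < 1).

(** Multiplying every y by a real t keeps the hypothesis and multiplies the sum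
    by t, so [Qbound] forces t |sum| < 1 for every t > 0; t = 1 / |sum| would
    contradict this. *)
Lemma polar_sum_eq0 m (x y : 'I_m -> K) :
  (forall j, \sum_(i < m) '[x i, z j] *: y i = 0) ->
  \sum_(i < m) polar Q (y i) (x i) = 0.
Proof.
move=> xy0; set v := \sum_(i < m) _.
apply/eqP/negPn/negP => v0.
(* the scalars of polar_real_scalel are real, hence the detour through Re *)
pose t := (complex.Re `|v|)^-1.
have tE : t%:C = `|v|^-1
  by rewrite fmorphV; congr (_^-1); exact: RRe_real (normr_real v).
have := @Qbound m x (fun i => t%:C *: y i).
have -> : \sum_(i < m) polar Q (t%:C *: y i) (x i) = t%:C *: v.
  by rewrite scaler_sumr; apply: eq_bigr => i _; exact: polar_real_scalel.
rewrite normrZ tE normfV normr_id mulVf ?normr_eq0// ltxx => h.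
apply: notF; apply: h => j.
under eq_bigr do rewrite scalerA mulrC -scalerA.
by rewrite -scaler_sumr xy0 scaler0 normr0 ltcR.
Qed.

(** A pair p stands for the operator [ketbra p.1 p.2].  The hypothesis says that
    the sum of these operators kills every z j, the conclusion that any linear
    extension of Q must kill it. *)
Lemma complex_polar_sum_eq0 (ps : seq (K * K)) :
  (forall j, \sum_(p <- ps) '[p.2, z j] *: p.1 = 0) ->
  \sum_(p <- ps) complex_polar Q p.1 p.2 = 0.
Proof.
move=> ps0; rewrite -scaler_sumr big_split/= -scaler_sumr !(big_tnth _ _ ps).
rewrite !polar_sum_eq0 ?scaler0 ?addr0 ?scaler0// => j.
  under eq_bigr do rewrite innerZl -scalerA.
  rewrite -scaler_sumr.
  rewrite -(big_tnth _ _ ps xpredT (fun p => '[p.2, z j] *: p.1)) ps0.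
  by rewrite scaler0.
by rewrite -(big_tnth _ _ ps xpredT (fun p => '[p.2, z j] *: p.1)).
Qed.

(** [Qbound] for a single pair (x, e) or (x, i e) bounds the polar form on a
    ball around 0. *)
Lemma complex_polar_continuous e : continuous (complex_polar Q ^~ e).
Proof.
pose f : {linear K -> 'B(H)} := HB.pack (complex_polar Q ^~ e)
  (GRing.isLinear.Build R[i] K 'B(H) *:%R (complex_polar Q ^~ e)
     (complex_polar_linear Qpar Qeven Qi Qcont e)).
suff : continuous f by [].
apply: bounded_linear_continuous.
pose s : R[i] := \sum_(j < n) `|'[e, z j]|.
have s0 : 0 <= s by apply: sumr_ge0.
pose r := d%:C / (1 + s).
have r0 : 0 < r by rewrite divr_gt0 ?ltcR// ltr_pwDl.
have polar_lt x a : `|x| < r -> `|a| = 1 -> `|polar Q x (a *: e)| < 1.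
  move=> xr a1.
  have := @Qbound 1 (fun=> a *: e) (fun=> x); rewrite !big_ord1; apply => j.
  rewrite big_ord1 normrZ innerZl normrM norm_conjC a1 mul1r.
  apply: le_lt_trans (_ : (1 + s) * `|x| < _); last first.
    by rewrite mulrC -ltr_pdivlMr ?ltr_pwDl.
  apply: ler_wpM2r => //; rewrite /s (bigD1 j)//= addrCA lerDl.
  by rewrite addr_ge0 ?sumr_ge0.
apply/ex_bound; exists 1.
have : \forall x \near (0 : K), `|x| < r.
  apply/nbhs_ballP; exists r => // x.
  by rewrite -ball_normE /ball_/= sub0r normrN.
apply: filterS => x xr; change (`|complex_polar Q x e| <= 1).
rewrite /complex_polar normrZ normfV normr_nat ler_pdivrMl ?ltr0n// mulr1.
have := polar_lt x 1 xr (normr1 _); rewrite scale1r => p1.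
have p2 := polar_lt x 'i xr (normCi _).
apply: le_trans (ler_normD _ _) _; rewrite normrZ normCi mul1r.
apply: le_trans (lerD (ltW p1) (ltW p2)) _.
by rewrite -[1 + 1](natrD _ 1 1) ler_nat.
Qed.

(** With a local unit (e_k) for the z j, every T agrees on the z j with the
    operator of the pairs (T e_k, e_k).  The key claim [phiE] says that any
    other finite list of pairs with the same values at the z j computes the
    same phi T; positivity and the values on the operators x x^* are
    obtained by choosing a list suited to T. *)
Lemma positive_extension_exists : exists phi : {linear 'B(K) -> 'B(H)},
  [/\ positive_map phi,
      forall x : K, phi (ketbra x x) = Q x
    & strong_uniform_continuous phi].
Proof.
have [es esP] := local_unit (codom z).
pose phi0 (T : 'B(K)) := \sum_(e <- es) complex_polar Q (T e) e.
have phil : linear phi0.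
  move=> a S T; rewrite /phi0 scaler_sumr -big_split; apply: eq_bigr => e _.
  by rewrite bopD bopZ complex_polar_linear.
pose phi : {linear 'B(K) -> 'B(H)} := HB.pack phi0
  (GRing.isLinear.Build R[i] 'B(K) 'B(H) *:%R phi0 phil).
have LN x y : complex_polar Q (- x) y = - complex_polar Q x y.
  have L0 : complex_polar Q 0 y = 0.
    have := complex_polar_linear Qpar Qeven Qi Qcont y (-1) 0 0.
    by rewrite scaler0 addr0 scaleN1r addNr.
  have := complex_polar_linear Qpar Qeven Qi Qcont y (-1) x 0.
  by rewrite L0 !addr0 !scaleN1r.
have phiE (T : 'B(K)) (xs : seq (K * K)) :
    (forall j, T (z j) = \sum_(p <- xs) '[p.2, z j] *: p.1) ->
    phi T = \sum_(p <- xs) complex_polar Q p.1 p.2.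
  move=> Tz; apply/eqP; rewrite -subr_eq0; apply/eqP.
  pose ps := [seq (T e, e) | e <- es] ++ [seq (- p.1, p.2) | p <- xs].
  have <- : \sum_(p <- ps) complex_polar Q p.1 p.2 =
      phi T - \sum_(p <- xs) complex_polar Q p.1 p.2.
    rewrite big_cat !big_map /= -sumrN; congr (_ + _).
    by apply: eq_bigr => p _; exact: LN.
  apply: complex_polar_sum_eq0 => j; rewrite big_cat !big_map /=.
  under eq_bigr do rewrite -linearZ.
  rewrite -linear_sum esP ?codom_f//= Tz.
  under [X in _ + X]eq_bigr do rewrite scalerN.
  by rewrite sumrN subrr.
exists phi; split.
- move=> T T0; have [xs [_ xsT]] := positive_op_interpolation (codom z) T0.
  rewrite (phiE T [seq (x, x) | x <- xs]) => [|j]; last first.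
    by rewrite big_map /= xsT ?codom_f.
  rewrite big_map; apply: big_ind => [u|S1 S2 S1_ge0 S2_ge0 u|x _].
  - by rewrite innerC inner0l conjC0.
  - by rewrite bopD innerDr addr_ge0.
  - by rewrite diag_complex_polar.
- move=> x; rewrite (phiE _ [:: (x, x)]) => [|j]; rewrite big_seq1//.
  exact: diag_complex_polar.
- suff : forall s : seq K, continuous (fun T : strong_bop K =>
      \sum_(e <- s) complex_polar Q ((T : 'B(K)) e) e) by apply.
  elim=> [|e s IH] T.
    rewrite [f in continuous_at _ f](_ : _ = cst 0).
      exact: cst_continuous.
    by apply/funext => S; rewrite big_nil.
  rewrite [f in continuous_at _ f](_ : _ =
      fun S : strong_bop K => complex_polar Q ((S : 'B(K)) e) e +
        \sum_(e <- s) complex_polar Q ((S : 'B(K)) e) e); last first.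
    by apply/funext => S; rewrite big_cons.
  have ec : continuous_at T
      ((complex_polar Q ^~ e) \o (fun S : strong_bop K => (S : 'B(K)) e)).
    apply: continuous_comp; first exact: strong_eval_continuous.
    exact: complex_polar_continuous.
  exact: (cvgD ec (IH T)).
Qed.

End Extension.

(** * Existence and uniqueness of the positive map *)

Theorem theorem4p3 (R : realType) (K H : hilbertType R) (Q : K -> 'B(H))
    (Qpos : positive_parallelogram Q)
    (Qinv : forall x : K, Q (- x) = Q x /\ Q ('i *: x) = Q x)
    (Qcont : forall x y : K,
      {for (0 : R), continuous (fun a : R => Q (x + a%:C *: y))})
    (Qstrong : forall e : R, 0 < e ->
      exists (n : nat) (z : 'I_n -> K) (d : R), 0 < d /\
        forall (m : nat) (x y : 'I_m -> K),
          (forall j : 'I_n, `|\sum_(i < m) '[x i, z j] *: y i| < d%:C) ->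
          `|\sum_(i < m) (Q (y i + x i) - Q (y i - x i))| < e%:C) :
  exists! phi : {linear 'B(K) -> 'B(H)},
    [/\ positive_map phi,
        forall x : K, phi (ketbra x x) = Q x
      & strong_uniform_continuous phi].
Proof.
have [Qpar Q0] := Qpos.
have Qeven x : Q (- x) = Q x by have [] := Qinv x.
have Qi x : Q ('i *: x) = Q x by have [] := Qinv x.
have [n [z [d [d0 Qbound]]]] := Qstrong 1 ltr01.
have [phi [phi_pos phi_Q phi_cont]] :=
  positive_extension_exists Qpar Q0 Qeven Qi Qcont d0 Qbound.
exists phi; split=> [|psi [_ psi_Q psi_cont]].
  by split=> //; exact: phi_pos.
apply: linear_ext; apply: strong_continuous_ketbra_eq => // x y.
by rewrite (ketbra_polarization x y phi_Q) (ketbra_polarization x y psi_Q).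
Qed.
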